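(* Let $X$ and $Y$ be ordered Banach spaces with closed generating cones. Then every order bounded linear operator $T:X\to Y$ is continuous.
   Context: All vector spaces are real. An ordered Banach space is a Banach space $X$ that is also an ordered vector space with positive cone $X_+$ (with $X_+\cap(-X_+)=\{0\}$); no compatibility of norm and order is assumed beyond what is stated. The cone is generating if $X=X_+-X_+$, and closed means norm closed. A linear operator $T:X\to Y$ is order bounded if for every order interval $[a,b]=\{x\in X:a\le x\le b\}$ in $X$ the set $T[a,b]$ is contained in an order interval of $Y$. *)

(* Defs.v *)
From HB Require Import structures.
From mathcomp Require Import all_boot all_order all_algebra.
From mathcomp Require Import all_classical all_reals all_analysis.

Set Implicit Arguments.
Unset Strict Implicit.
Unset Printing Implicit Defensive.

Import Order.TTheory GRing.Theory Num.Theory.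
Import numFieldNormedType.Exports.

Local Open Scope classical_set_scope.
Local Open Scope ring_scope.

(* The order is a field of its own rather than an [Order.POrder] structure:
   Hierarchy Builder rejects a structure joining the latter with normed
   modules, because [Num.NumDomain] already inherits from both. *)
HB.mixin Record isOrderedLmodule (R : numDomainType) V of GRing.Lmodule R V := {
  lev : V -> V -> Prop ;
  lev_refl : forall x, lev x x ;
  lev_anti : forall x y, lev x y -> lev y x -> x = y ;
  lev_trans : forall y x z, lev x y -> lev y z -> lev x z ;
  levD2r : forall z x y, lev x y -> lev (x + z) (y + z) ;
  levZ : forall (a : R) x y, 0 <= a -> lev x y -> lev (a *: x) (a *: y)
}.

#[short(type="orderedLmodType")]
HB.structure Definition OrderedLmodule (R : numDomainType) :=
  {V of GRing.Lmodule R V & isOrderedLmodule R V}.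

(* No axiom relates the norm to the order. *)
#[short(type="orderedBanachType")]
HB.structure Definition OrderedBanach (R : realType) :=
  {V of CompleteNormedModule R V & isOrderedLmodule R V}.

Definition pos_cone (R : numDomainType) (X : orderedLmodType R) : set X :=
  [set x | lev 0 x].
Arguments pos_cone {R} X _.

Definition generating_cone (R : numDomainType) (X : orderedLmodType R) : Prop :=
  forall x : X, exists u v : X, [/\ pos_cone X u, pos_cone X v & x = u - v].
Arguments generating_cone {R} X.

Definition order_interval (R : numDomainType) (X : orderedLmodType R)
  (a b : X) : set X := [set x | lev a x /\ lev x b].

Definition order_bounded (R : numDomainType) (X Y : orderedLmodType R)
    (T : X -> Y) : Prop :=
  forall a b : X, exists c d : Y,
    T @` order_interval a b `<=` order_interval c d.

(* Main.v *)
(** Let [B] be the set of all [u - v] with [u], [v] positive of norm at most 1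
    and [`|T (u - v)| <= 1].  It is convex, symmetric and absorbing, so by
    Baire's theorem it is dense in some ball, and successive approximation
    writes every [x] of that ball as the sum of a series [4^-n b_n] with [b_n]
    in [B].  For [b_n = u_n - v_n] and [w] the sum of [2^-n (u_n + v_n)], the
    [N]-th tail of the series lies in [[-2^-N w, 2^-N w]].  As [T] maps
    [[-w, w]] into some [[c, d]], it maps this tail into [[2^-N c, 2^-N d]].
    The series [4^-n T b_n] converges, and since the cone of [Y] is closed its
    sum is [T x]; hence [`|T x| <= 2].  This merges Ando's decomposition theorem
    and the closed graph theorem into a single use of Baire's theorem. *)

Require Import Defs.
From mathcomp Require Import ssrAC all_boot all_order all_algebra.
From mathcomp Require Import all_classical all_reals all_analysis.
From mathcomp Require Import ring lra.
Import Order.TTheory GRing.Theory Num.Theory.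
Import numFieldNormedType.Exports.
Local Open Scope classical_set_scope.
Local Open Scope ring_scope.

(** By Baire, the closure of some multiple of [B] contains a ball around a point [x0]. Approximating
    two points symmetric about [x0] and subtracting moves the centre to 0; [B_mid] is the part of
    convexity and symmetry that this requires. *)
Lemma baire_approx (R : realType) (X : completeNormedModType R) (B : set X)
    (B_mid : forall a b, B a -> B b -> B (2^-1 *: (a - b)))
    (B_abs : forall x, exists n : nat, exists2 b, B b & x = n.+1%:R *: b) :
  exists2 r : R, 0 < r & forall (x : X) (e : R), `|x| < r -> 0 < e ->
    exists2 b, B b & `|x - b| < e.
Proof.
pose C n : set X := closure ((fun b : X => n.+1%:R *: b) @` B).
have capC0 : \bigcap_n ~` C n = set0.
  rewrite -subset0 => x xC; have [n [b Bb xE]] := B_abs x.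
  by apply: (xC n Logic.I); apply: subset_closure; exists b.
have [n nd] : exists n, ~ dense (~` C n).
  apply/existsNP => alld.
  have : dense (\bigcap_n ~` C n).
    apply: Baire => n; split; last exact: alld.
    by apply: closed_openC; exact: closed_closure.
  rewrite capC0 => /(_ setT) /(_ (ex_intro _ 0 Logic.I) openT).
  by rewrite setI0 => -[].
have [A [[x0 /open_nbhs_nbhs /nbhs_ballP [r r0 x0A]]] AC0] := denseNE nd.
have x0C y : `|x0 - y| < r -> C n y.
  move=> yr; apply: contrapT => nCy.
  have : (A `&` ~` C n) y by split => //; apply: x0A; rewrite -ball_normE.
  by rewrite AC0.
have n0 : (0 : R) < n.+1%:R by rewrite ltr0n.
have approx_pt y (e : R) : 0 < e -> `|x0 - y| < r ->
    exists2 b, B b & `|y - n.+1%:R *: b| < e.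
  move=> e0 /x0C /(_ (ball y e) (nbhsx_ballx y e e0)) [_ [[b Bb <-]]].
  by rewrite -ball_normE; exists b.
exists (r / n.+1%:R) => [|x e xr e0]; first exact: divr_gt0.
have nxr : `|n.+1%:R *: x| < r.
  by rewrite normrZ gtr0_norm// mulrC -ltr_pdivlMr.
have [|b1 Bb1 h1] := approx_pt (x0 + n.+1%:R *: x) e e0.
  by rewrite opprD addNKr normrN.
have [|b2 Bb2 h2] := approx_pt (x0 - n.+1%:R *: x) e e0.
  by rewrite opprB addrCA subrr addr0.
exists (2^-1 *: (b1 - b2)); first exact: B_mid.
(* The error is the difference of the two approximation errors divided by [2 * n.+1%:R], hence
   smaller than [e]. *)
have -> : x - 2^-1 *: (b1 - b2) = (2 * n.+1%:R)^-1 *: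
    ((x0 + n.+1%:R *: x - n.+1%:R *: b1) -
     (x0 - n.+1%:R *: x - n.+1%:R *: b2)).
  rewrite !opprD !opprK (AC (3*3) ((1*4)*((2*5)*(3*6)))) /= subrr add0r.
  have c0 := gt_eqF n0.
  rewrite -scalerDl [- _ + _]addrC -scalerBr -scalerN opprB.
  rewrite [RHS]scalerDr !scalerA; congr (_ + _).
    by rewrite -[LHS]scale1r; congr (_ *: _); field; rewrite ?c0.
  by congr (_ *: _); field; rewrite ?c0.
rewrite normrZ gtr0_norm ?invr_gt0 ?mulr_gt0// mulrC ltr_pdivrMr ?mulr_gt0//.
apply: (le_lt_trans (ler_normB _ _)).
apply: (lt_le_trans (ltrD h1 h2)).
have : (1 : R) <= n.+1%:R by rewrite ler1n.
nra.
Qed.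

(** Approximating within [h * r] leaves a remainder that, divided by [h], lies again in the ball of
    radius [r], so the step can be repeated. *)
Lemma approx_series (R : realType) (X : normedModType R) (B : set X) (r h : R)
    (h0 : 0 < h) (h1 : h < 1)
    (B_approx : forall (x : X) (e : R), `|x| < r -> 0 < e ->
      exists2 b, B b & `|x - b| < e) (x : X) (xr : `|x| < r) :
  exists2 b : nat -> X, forall n, B (b n) &
    series (fun n => h ^+ n *: b n) @ \oo --> x.
Proof.
have r0 : 0 < r by exact: le_lt_trans xr.
(* The value 0 outside the ball is a default: the iterates [y n] never leave the ball. *)
have /choice[g gP] : forall y, exists b, `|y| < r -> B b /\ `|y - b| < h * r.
  move=> y; have [yr|] := boolP (`|y| < r); last by exists 0.
  by have [b Bb yb] := B_approx y (h * r) yr (mulr_gt0 h0 r0); exists b.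
pose y := fix y n : X := if n is m.+1 then h^-1 *: (y m - g (y m)) else x.
have yr n : `|y n| < r.
  elim: n => //= n /gP[_ IH].
  by rewrite normrZ gtr0_norm ?invr_gt0// mulrC ltr_pdivrMr// mulrC.
exists (g \o y) => [n|]; first by have [] := gP _ (yr n).
have SE n : x - series (fun n => h ^+ n *: (g \o y) n) n = h ^+ n *: y n.
  elim: n => [|n IH]; first by rewrite seriesEnat/= big_geq// subr0 expr0 scale1r.
  rewrite seriesSr opprD addrA IH /= exprSr scalerA mulfK ?gt_eqF//.
  by rewrite scalerBr.
apply/cvgrPdist_lt => e e0; near=> n.
rewrite SE normrZ normrX gtr0_norm//.
apply: (@le_lt_trans _ _ (h ^+ n * r)).
  by rewrite ler_wpM2l ?exprn_ge0 ?ltW.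
rewrite -ltr_pdivlMr// -[_ ^+ n]gtr0_norm ?exprn_gt0// -[`|_|]normrN -sub0r.
near: n.
have /cvg_expr/cvgrPdist_lt : `|h| < 1 by rewrite gtr0_norm.
by apply; exact: divr_gt0.
Unshelve. all: by end_near. Qed.

Lemma cvg_geometric_scale (R : realType) (X : completeNormedModType R) (a : R)
    (b : nat -> X) (a0 : 0 <= a) (a1 : a < 1) (b1 : forall n, `|b n| <= 1) :
  cvgn (series (fun n => a ^+ n *: b n)).
Proof.
apply: normed_cvg; apply: (@series_le_cvg _ _ (geometric 1 a)) => [n|n|n|].
- exact: normr_ge0.
- by rewrite /= mul1r exprn_ge0.
- rewrite /= mul1r normrZ ger0_norm ?exprn_ge0// ler_piMr// exprn_ge0//.
- by apply: is_cvg_geometric_series; rewrite ger0_norm.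
Qed.

Section cone.
Variables (R : numDomainType) (X : orderedLmodType R).
Local Notation pos := (pos_cone X).

Lemma lev_sub (x y : X) : lev x y <-> pos (y - x).
Proof.
split=> [/(levD2r (- x))|/(levD2r x)]; first by rewrite subrr.
by rewrite subrK add0r.
Qed.

Lemma pos_coneD (x y : X) : pos x -> pos y -> pos (x + y).
Proof.
move=> x0 /(levD2r x); rewrite add0r addrC => xy.
exact: lev_trans x0 xy.
Qed.

Lemma pos_coneZ (a : R) (x : X) : 0 <= a -> pos x -> pos (a *: x).
Proof. by move=> a0 /(levZ _ _ _ a0); rewrite scaler0. Qed.

Lemma pos_cone_sum (f : nat -> X) n : (forall k, pos (f k)) -> pos (series f n).
Proof.
move=> f0; elim: n => [|n IH].
  by rewrite seriesEnat/= big_geq//; exact: lev_refl.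
by rewrite seriesSr; exact: pos_coneD.
Qed.

(** For [n >= N] the weight [h ^+ (2 * n)] is at most [h ^+ N * h ^+ n], so each term of the tail is
    dominated by [h ^+ N] times the matching term of the larger series. The terms of that series
    before [N] are positive and only help. *)
Lemma geometric_tail_le (h : R) (u v : nat -> X) (N M : nat) :
    0 <= h <= 1 -> (forall n, pos (u n)) -> (forall n, pos (v n)) ->
    (N <= M)%N ->
  let S := series (fun n => (h ^+ 2) ^+ n *: (u n - v n)) in
  pos (h ^+ N *: series (fun n => h ^+ n *: (u n + v n)) M - (S M - S N)).
Proof.
move=> /andP[h0 h1] u0 v0 NM /=.
have uv0 n : pos (h ^+ n *: (u n + v n)).
  by apply: pos_coneZ; [exact: exprn_ge0|exact: pos_coneD].
rewrite -(subnKC NM); elim: (M - N)%N => [|k IH].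
  rewrite addn0 subrr subr0; apply: pos_coneZ; first exact: exprn_ge0.
  exact: pos_cone_sum.
rewrite addnS !seriesSr; set m := (N + k)%N in IH *.
set W := series _ _ in IH *; set S := series _ _ in IH *.
set S' := series _ _ in IH *.
have -> : h ^+ N *: (W + h ^+ m *: (u m + v m)) -
    (S + (h ^+ 2) ^+ m *: (u m - v m) - S') =
    (h ^+ N *: W - (S - S')) +
    ((h ^+ N * h ^+ m - (h ^+ 2) ^+ m) *: u m +
     (h ^+ N * h ^+ m + (h ^+ 2) ^+ m) *: v m).
  rewrite !scalerDr !scalerDl !scalerN !scaleNr !opprD !opprK !scalerA.
  by rewrite (AC ((1*2)*(1*2*1)) ((1*(4*7))*((2*5)*(3*6)))) /=.
have hm : (h ^+ 2) ^+ m <= h ^+ N * h ^+ m.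
  rewrite -exprM mulnC muln2 -addnn exprD ler_wpM2r ?exprn_ge0//.
  by rewrite ler_wiXn2l// leq_addr.
apply: pos_coneD => //; apply: pos_coneD; apply: pos_coneZ => //.
  by rewrite subr_ge0.
by rewrite addr_ge0 ?mulr_ge0 ?exprn_ge0.
Qed.

End cone.

Lemma norm_half_sum (R : numFieldType) (V : normedModType R) (a b : V) :
  `|a| <= 1 -> `|b| <= 1 -> `|2^-1 *: (a + b)| <= 1.
Proof.
move=> a1 b1; rewrite normrZ gtr0_norm ?invr_gt0// mulrC ler_pdivrMr// mul1r.
by apply: (le_trans (ler_normD _ _)); exact: lerD.
Qed.

Theorem proposition2p10 (R : realType) (X Y : orderedBanachType R)
    (X_closed : closed (pos_cone X)) (X_gen : generating_cone X)
    (Y_closed : closed (pos_cone Y)) (Y_gen : generating_cone Y)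
    (T : {linear X -> Y}) (T_obd : order_bounded T) :
  continuous T.
Proof.
pose B : set X := [set x | `|T x| <= 1 /\ exists u v,
  [/\ pos_cone X u, pos_cone X v, `|u| <= 1, `|v| <= 1 & x = u - v]].
have B_mid a b : B a -> B b -> B (2^-1 *: (a - b)).
  move=> [Ta [u [v [u0 v0 u1 v1 aE]]]] [Tb [u' [v' [u'0 v'0 u'1 v'1 bE]]]].
  split; first by rewrite linearZ linearB; apply: norm_half_sum; rewrite ?normrN.
  (* Subtracting [b] exchanges the roles of its two positive parts. *)
  exists (2^-1 *: (u + v')), (2^-1 *: (v + u')); split.
  - by apply: pos_coneZ; [rewrite invr_ge0 ler0n|exact: pos_coneD].
  - by apply: pos_coneZ; [rewrite invr_ge0 ler0n|exact: pos_coneD].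
  - exact: norm_half_sum.
  - exact: norm_half_sum.
  - by rewrite -scalerBr aE bE opprB opprD addrACA.
have B_abs x : exists n : nat, exists2 b, B b & x = n.+1%:R *: b.
  have [u [v [u0 v0 xE]]] := X_gen x.
  (* [s] bounds all three norms that [B] restricts, so one scaling serves them together. *)
  pose s : R := `|u| + `|v| + `|T x|; exists (Num.truncn s).
  set c : R := (Num.truncn s).+1%:R.
  have c0 : (0 : R) < c by rewrite ltr0n.
  have sc : s < c by exact: truncnS_gt.
  have [[u_ge0 v_ge0] T_ge0] := (normr_ge0 u, normr_ge0 v, normr_ge0 (T x)).
  have scale_le (V : normedModType R) (z : V) : `|z| <= s -> `|c^-1 *: z| <= 1.
    move=> zs; rewrite normrZ gtr0_norm ?invr_gt0// mulrC ler_pdivrMr// mul1r.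
    exact: le_trans zs (ltW sc).
  exists (c^-1 *: x); last by rewrite scalerA divff ?scale1r ?gt_eqF.
  split; first by rewrite linearZ; apply: scale_le; rewrite /s; lra.
  exists (c^-1 *: u), (c^-1 *: v); split.
  - by apply: pos_coneZ; rewrite // invr_ge0 ltW.
  - by apply: pos_coneZ; rewrite // invr_ge0 ltW.
  - by apply: scale_le; rewrite /s; lra.
  - by apply: scale_le; rewrite /s; lra.
  - by rewrite -scalerBr xE.
have [r r0 B_approx] := @baire_approx R X B B_mid B_abs.
suff T_le2 x : `|x| < r -> `|T x| <= 2.
  apply/linear_bounded_continuous; rewrite /bounded_near; near=> M.
  apply/nbhs_normP; exists r => //= x; rewrite /= sub0r normrN => /T_le2.
  move=> /le_trans; apply; near: M; exact: nbhs_pinfty_ge.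
(* The series for [x] gets ratio [h ^+ 2]: one factor [h] makes the sum [w] converge, the other
   makes the order bounds of the tails shrink. *)
move=> xr; pose h : R := 2^-1.
have h0 : 0 < h by rewrite invr_gt0.
have h1 : h < 1 by rewrite invf_lt1// ltr1n.
have hh0 : 0 < h ^+ 2 by exact: exprn_gt0.
have hh1 : h ^+ 2 < 1 by rewrite exprn_ilt1// ltW.
have [b Bb bx] := @approx_series R X B r _ hh0 hh1 B_approx x xr.
have /choice[uv uvP] : forall n, exists p : X * X,
    [/\ pos_cone X p.1, pos_cone X p.2, `|p.1| <= 1, `|p.2| <= 1 &
        b n = p.1 - p.2].
  by move=> n; have [_ [u [v uvP]]] := Bb n; exists (u, v).
pose u n := (uv n).1; pose v n := (uv n).2.
have u0 n : pos_cone X (u n) by have [] := uvP n.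
have v0 n : pos_cone X (v n) by have [] := uvP n.
have bE : b = fun n => u n - v n by apply/funext => n; have [] := uvP n.
pose S := series (fun n => (h ^+ 2) ^+ n *: b n).
pose W := series (fun n => h ^+ n *: (u n + v n)).
have W_cvg : cvgn W.
  (* Halving brings the terms into the unit ball, as [cvg_geometric_scale] demands. *)
  pose half_sum n := 2^-1 *: (u n + v n).
  have -> : W = 2 *: series (fun n => h ^+ n *: half_sum n).
    rewrite /W; apply/funext => n; rewrite fctE /series /= scaler_sumr.
    apply: eq_bigr => k _; rewrite /half_sum !scalerA mulrAC divff ?mul1r//.
  apply: is_cvgZl_tmp; apply: cvg_geometric_scale => [||n]; [exact: ltW| by [] |].
  by have [_ _ u1 v1 _] := uvP n; exact: norm_half_sum.
pose w := limn W.
have tail_le N : lev (- (h ^+ N *: w)) (x - S N) /\ lev (x - S N) (h ^+ N *: w).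
  have hW : h ^+ N *: W n @[n --> \oo] --> h ^+ N *: w.
    exact: cvgZl_tmp.
  have h01 : 0 <= h <= 1 by rewrite !ltW.
  split; apply/lev_sub.
    rewrite opprK addrC.
    apply: (closed_cvg _ X_closed _ _ (cvgD hW (cvgB bx (cvg_cst (S N))))).
    exists N => // n /= Nn.
    (* Exchanging [u] and [v] negates the series, which turns the upper bound into the lower one. *)
    have := geometric_tail_le _ _ _ _ _ _ _ h01 v0 u0 Nn.
    have -> : (fun n => (h ^+ 2) ^+ n *: (v n - u n)) =
        (fun n => - ((h ^+ 2) ^+ n *: b n)).
      by apply/funext => k; rewrite bE -scalerN opprB.
    have -> : (fun n => h ^+ n *: (v n + u n)) = (fun n => h ^+ n *: (u n + v n)).
      by apply/funext => k; rewrite addrC.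
    rewrite -/W /series/= !sumrN -opprD opprK; exact.
  apply: (closed_cvg _ X_closed _ _ (cvgB hW (cvgB bx (cvg_cst (S N))))).
  exists N => // n /= Nn.
  by have := geometric_tail_le _ _ _ _ _ _ _ h01 u0 v0 Nn; rewrite /S bE.
(* The bound on [T] built into [B] gives convergence by completeness of [Y]; that the limit is [T x]
   remains to be shown. *)
have TS_cvg : cvgn (T \o S).
  have -> : T \o S = series (fun n => (h ^+ 2) ^+ n *: T (b n)).
    apply/funext => n; rewrite /= /S /series/= linear_sum.
    by apply: eq_bigr => k _; rewrite linearZ.
  apply: cvg_geometric_scale => [||n]; [exact: ltW| by [] |].
  by have [] := Bb n.
have [c [d Tcd]] := T_obd (- w) w.
have TxS N : lev (h ^+ N *: c) (T x - T (S N)) /\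
             lev (T x - T (S N)) (h ^+ N *: d).
  have hN0 : 0 < h ^+ N by exact: exprn_gt0.
  have [lo up] := tail_le N.
  (* Rescaled by the inverse of [h ^+ N], every tail lies in the same interval from [- w] to [w], so
     [c] and [d] do not depend on [N]. *)
  have [|cT Td] := Tcd (T ((h ^+ N)^-1 *: (x - S N))).
    exists ((h ^+ N)^-1 *: (x - S N)) => //.
    have hV0 : 0 <= (h ^+ N)^-1 by rewrite invr_ge0 ltW.
    have := levZ _ _ _ hV0 lo; have := levZ _ _ _ hV0 up.
    by rewrite scalerN !scalerA mulVf ?gt_eqF// !scale1r.
  have := levZ _ _ _ (ltW hN0) cT; have := levZ _ _ _ (ltW hN0) Td.
  by rewrite linearZ scalerA mulfV ?gt_eqF// scale1r linearB.
have TxE : T x = limn (T \o S).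
  have hc0 (z : Y) : h ^+ n *: z @[n --> \oo] --> (0 : Y).
    rewrite -(scale0r z); apply: cvgZr_tmp; apply: cvg_expr.
    by rewrite gtr0_norm.
  have TxS_cvg : T x - T (S n) @[n --> \oo] --> T x - limn (T \o S).
    by apply: cvgB => //; exact: cvg_cst.
  (* Both order bounds tend to 0, so closedness of the cone puts the difference below and above
     0. *)
  apply/eqP; rewrite -subr_eq0; apply/eqP/lev_anti; apply/lev_sub.
    apply: (closed_cvg _ Y_closed _ _ (cvgB (hc0 d) TxS_cvg)).
    by apply: nearW => n; have [_ /lev_sub] := TxS n.
  rewrite subr0 -[X in pos_cone Y X]subr0.
  apply: (closed_cvg _ Y_closed _ _ (cvgB TxS_cvg (hc0 c))).
  by apply: nearW => n; have [/lev_sub] := TxS n.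
rewrite TxE -lim_norm//; apply: limr_le; first exact: is_cvg_norm.
apply: nearW => n; rewrite /= /S /series/= linear_sum.
apply: (le_trans (ler_norm_sum _ _ _)).
(* The full geometric sum is 4/3, which is below 2. *)
apply: (@le_trans _ _ (series (geometric 1 (h ^+ 2)) n)).
  apply: ler_sum => k _; rewrite linearZ /= normrZ gtr0_norm ?exprn_gt0//.
  by rewrite mul1r ler_piMr//; [exact/exprn_ge0/ltW|have [] := Bb k].
have hh1' : `|h ^+ 2| < 1 by rewrite gtr0_norm.
apply: le_trans (geometric_le_lim n ler01 hh0 hh1') _.
rewrite mul1r invf_ple ?posrE ?subr_gt0//.
rewrite /h expr2; lra.
Unshelve. all: by end_near. Qed.
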